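(* For every Boolean algebra $A$, seen as a $PMV_f$-algebra, there is a set $X$ such that $A$ is (up to isomorphism) a subalgebra of the $PMV_f$-algebra $2^X$, and the semi-low $f_u$-ring $A^\sharp$ associated to $A$ is (up to isomorphism) a subring of the semi-low $f_u$-ring $B(\mathbb Z^X)$ of bounded functions $X\to\mathbb Z$.
   Context: **MV-algebras.** An MV-algebra is $(A,\oplus,\neg,0)$ with $(A,\oplus,0)$ a commutative monoid, $\neg\neg x=x$, $x\oplus\neg 0=\neg 0$, $\neg(\neg x\oplus y)\oplus y=\neg(\neg y\oplus x)\oplus x$. Put $u=\neg 0$, $x\odot y=\neg(\neg x\oplus\neg y)$, $x\ominus y=\neg(\neg x\oplus y)$; the lattice order is $x\le y\iff x\ominus y=0$. An ideal is a nonempty down-closed subset closed under $\oplus$; an ideal $P$ is prime if $a\wedge b\in P$ implies $a\in P$ or $b\in P$; $Spec(A)$ is the set of prime ideals. For an ideal $I$, $A/I$ is the quotient by $x\equiv_I y\iff (x\ominus y)\oplus(y\ominus x)\in I$, with classes $[x]_I$. **$PMV_f$-algebras.** A $PMV_f$-algebra is an MV-algebra with an associative commutative product $\cdot$ such that for all $a,b,c$: $a0=0$; $a(b\oplus c)\le ab\oplus ac$; $ab\le a\wedge b$; $a(b\ominus c)=ab\ominus ac$. For a $PMV_f$-algebra $A$ and a prime ideal $P$ of its underlying MV-algebra, $A/P$ is a totally ordered $PMV_f$-algebra. A Boolean algebra is regarded as a $PMV_f$-algebra with $\oplus=\vee$, $\neg$ the complement, and product $ab=a\wedge b$; in particular this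 applies to $2^X$ with pointwise operations. **$l$-rings.** Rings are commutative and associative. An $l$-ring is a ring whose additive group is a lattice-ordered abelian group and in which $x,y\ge0$ implies $xy\ge0$. An $l_u$-ring is an $l$-ring with a distinguished strong unit $u\ge0$ (for each $x$ there is an integer $n\ge 0$ with $|x|\le nu$); it is semi-low if $ab\le a\wedge b$ for all $a,b\in[0,u]$. An $f$-ring is an $l$-ring in which $a\wedge b=0$ and $c\ge0$ imply $ac\wedge b=a\wedge cb=0$; an $f_u$-ring is an $l_u$-ring that is an $f$-ring. $B(\mathbb Z^X)$ carries pointwise addition, multiplication and order, with strong unit the constant function $1$. **$A^\sharp$ for chains.** For a totally ordered $PMV_f$-algebra $A$, $A^\sharp$ is $\mathbb Z\times A$ with the identification $(m+1,0)=(m,u)$, addition $(m,a)+(n,b)=(m+n,a\oplus b)$ if $a\oplus b\ne u$ and $(m+n+1,a\odot b)$ if $a\oplus b=u$, negatives $-(m,a)=(-m-1,\neg a)$, lexicographic order (on representatives with second entry $\neq u$), strong unit $(0,u)=(1,0)$, and product $(m,a)(n,b)=mn(0,u^2)+m(0,bu)+n(0,au)+(0,ab)$. **$A^\sharp$ in general.** For a $PMV_f$-algebra $A$ and $a\in A$ let $(0,\widehat a)\in\prod_{P\in Spec(A)}(A/P)^\sharp$ be the element whose $P$-component is $(0,[a]_P)$. Then $A^\sharp$ is the sub-$l$-ring of this product generated by $\{(0,\widehat a):a\in A\}$, with strong unit $(0,\widehat u)$. *)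

(* Defs.v *)
From HB Require Import structures.
From mathcomp Require Import all_boot all_order all_algebra.
From mathcomp Require Import boolp classical_sets.
From Stdlib Require Import Relation_Operators.

Set Implicit Arguments.
Unset Strict Implicit.
Unset Printing Implicit Defensive.

Import Order.Theory GRing.Theory Num.Theory.
Local Open Scope quotient_scope.

(** * MV-algebras *)

HB.mixin Record Choice_isMV A of Choice A := {
  mv0 : A;
  mvadd : A -> A -> A;
  mvneg : A -> A;
  mvaddA : associative mvadd;
  mvaddC : commutative mvadd;
  mvadd0 : right_id mv0 mvadd;
  mvnegK : involutive mvneg;
  mvadd_neg0 : forall x, mvadd x (mvneg mv0) = mvneg mv0;
  mvlukasiewicz : forall x y,
    mvadd (mvneg (mvadd (mvneg x) y)) y = mvadd (mvneg (mvadd (mvneg y) x)) x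
}.

#[short(type="mvType")]
HB.structure Definition MV := {A of Choice_isMV A & Choice A}.

Declare Scope mv_scope.
Delimit Scope mv_scope with MV.
Bind Scope mv_scope with MV.sort.
Local Open Scope mv_scope.

Notation "x ⊕ y" := (mvadd x y) (at level 50, left associativity) : mv_scope.
Notation "¬ x" := (mvneg x) (at level 35, right associativity) : mv_scope.

Definition mvu {A : mvType} : A := ¬ mv0.
Definition mvmul {A : mvType} (x y : A) : A := ¬ (¬ x ⊕ ¬ y).
Definition mvsub {A : mvType} (x y : A) : A := ¬ (¬ x ⊕ y).

Notation "x ⊙ y" := (mvmul x y) (at level 40, left associativity) : mv_scope.
Notation "x ⊖ y" := (mvsub x y) (at level 50, left associativity) : mv_scope.

Definition mvle {A : mvType} (x y : A) : bool := x ⊖ y == mv0.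

(* The infimum for [mvle], see [mvle_meet] below. *)
Definition mvmeet {A : mvType} (x y : A) : A := x ⊖ (x ⊖ y).

Section MVTheory.
Variable A : mvType.
Implicit Types x y z t : A.

Lemma mvadd0x x : mv0 ⊕ x = x. Proof. by rewrite mvaddC mvadd0. Qed.

Lemma mvnegu : ¬ (mvu : A) = mv0. Proof. exact: mvnegK. Qed.

Lemma mvneg_inj : injective (@mvneg A). Proof. exact: can_inj mvnegK. Qed.

Lemma mvaddNx x : ¬ x ⊕ x = mvu.
Proof.
have := mvlukasiewicz x (mvu : A).
by rewrite /mvu mvadd_neg0 mvnegK mvadd0x.
Qed.

Lemma mvleE x y : mvle x y = (¬ x ⊕ y == mvu).
Proof. by rewrite /mvle /mvsub -(inj_eq mvneg_inj) mvnegK. Qed.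

Lemma mvadd_subK x y : mvle x y -> x ⊕ (y ⊖ x) = y.
Proof.
rewrite mvleE => /eqP xy; rewrite mvaddC [LHS]mvlukasiewicz xy.
by rewrite mvnegu mvadd0x.
Qed.

Lemma mvle_addr x y : mvle x (x ⊕ y).
Proof. by rewrite mvleE mvaddA mvaddNx mvaddC mvadd_neg0. Qed.

Lemma mvle_refl x : mvle x x.
Proof. by rewrite -{2}(mvadd0 x) mvle_addr. Qed.

Lemma mvle_trans y x z : mvle x y -> mvle y z -> mvle x z.
Proof. by move=> /mvadd_subK <- /mvadd_subK <-; rewrite -mvaddA mvle_addr. Qed.

Lemma mvle_anti x y : mvle x y -> mvle y x -> x = y.
Proof.
rewrite !mvleE => /eqP xy /eqP yx.
by have := mvlukasiewicz x y; rewrite xy yx mvnegu !mvadd0x.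
Qed.

Lemma mvle_sub x y z : mvle (x ⊖ y) z = mvle x (y ⊕ z).
Proof. by rewrite !mvleE mvnegK mvaddA. Qed.

Lemma mvle_add2l x y z : mvle y z -> mvle (x ⊕ y) (x ⊕ z).
Proof. by move=> /mvadd_subK <-; rewrite mvaddA mvle_addr. Qed.

Lemma mvle_add x y z t : mvle x y -> mvle z t -> mvle (x ⊕ z) (y ⊕ t).
Proof.
move=> xy zt; apply: (mvle_trans (mvle_add2l x zt)).
by rewrite ![_ ⊕ t]mvaddC mvle_add2l.
Qed.

Lemma mvle_addsub x y : mvle x (y ⊕ (x ⊖ y)).
Proof. by rewrite -mvle_sub mvle_refl. Qed.

Lemma mvle0 x : mvle mv0 x.
Proof. by rewrite -(mvadd0x x) mvle_addr. Qed.

Lemma mvlex0 x : mvle x mv0 -> x = mv0.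
Proof. by move=> /mvle_anti; apply; apply: mvle0. Qed.

Lemma mvle_neg x y : mvle (¬ x) (¬ y) = mvle y x.
Proof. by rewrite !mvleE mvnegK mvaddC. Qed.

Lemma mvsubxx x : x ⊖ x = mv0. Proof. exact/eqP/mvle_refl. Qed.

Lemma mvle_meet x y z : mvle z (mvmeet x y) = mvle z x && mvle z y.
Proof.
have lub (p q r : A) : mvle p r -> mvle q r -> mvle (q ⊕ (p ⊖ q)) r.
  move=> pr qr; rewrite -[r in X in mvle _ X](mvadd_subK qr) mvle_add2l //.
  by rewrite mvle_sub mvadd_subK.
have meetE : ¬ mvmeet x y = ¬ x ⊕ (¬ y ⊖ ¬ x).
  by rewrite /mvmeet /mvsub !mvnegK [y ⊕ _]mvaddC.
apply/idP/andP; last first.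
  case=> zx zy; rewrite -mvle_neg meetE.
  by apply: lub; rewrite mvle_neg.
move=> zm; split; apply: (mvle_trans zm); rewrite -mvle_neg meetE.
  exact: mvle_addr.
exact: mvle_addsub.
Qed.

End MVTheory.

Record is_ideal (A : mvType) (I : set A) : Prop := IsIdeal {
  ideal_nonempty : exists x, I x;
  ideal_down : forall x y, mvle x y -> I y -> I x;
  ideal_add : forall x y, I x -> I y -> I (x ⊕ y)
}.

(* Properness is not required.  The improper ideal contributes to the product
   defining [sharp] a factor with one element. *)
Definition is_prime_ideal (A : mvType) (P : set A) : Prop :=
  is_ideal P /\ forall a b, P (mvmeet a b) -> P a \/ P b.

Record ideal (A : mvType) := Ideal {
  ideal_set :> A -> Prop;
  idealP : is_ideal ideal_set
}.

Definition Spec (A : mvType) := {P : set A | is_prime_ideal P}.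

Definition Spec_ideal (A : mvType) (P : Spec A) : ideal A :=
  Ideal (proj1 (proj2_sig P)).
Coercion Spec_ideal : Spec >-> ideal.

(** * The quotient of an MV-algebra by an ideal *)

Section Quotient.
Variables (A : mvType) (I : ideal A).
Implicit Types x y z t : A.

Definition mvequiv x y : bool := `[< I ((x ⊖ y) ⊕ (y ⊖ x)) >].

Lemma ideal0 : I mv0.
Proof.
case: (ideal_nonempty (idealP I)) => x Ix.
exact: ideal_down (idealP I) _ _ (mvle0 x) Ix.
Qed.

Lemma mvequivE x y : mvequiv x y <-> I (x ⊖ y) /\ I (y ⊖ x).
Proof.
split=> [/asboolP Ixy|[Ixy Iyx]].
  split; apply: ideal_down (idealP I) _ _ _ Ixy; first exact: mvle_addr.
  by rewrite mvaddC mvle_addr.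
by apply/asboolP; apply: ideal_add (idealP I) _ _ _ _.
Qed.

Lemma mvequiv_refl : reflexive mvequiv.
Proof. by move=> x; apply/mvequivE; rewrite mvsubxx; split; apply: ideal0. Qed.

Lemma mvequiv_sym : symmetric mvequiv.
Proof. by move=> x y; rewrite /mvequiv mvaddC. Qed.

Lemma mvequiv_trans : transitive mvequiv.
Proof.
have tri (x y z : A) : mvle (x ⊖ z) ((x ⊖ y) ⊕ (y ⊖ z)).
  rewrite mvle_sub; apply: (mvle_trans (mvle_addsub x y)).
  rewrite [z ⊕ _]mvaddC -mvaddA [y ⊕ _]mvaddC mvle_add2l //.
  by rewrite mvaddC mvle_addsub.
move=> y x z /mvequivE[xy yx] /mvequivE[yz zy]; apply/mvequivE; split.
  apply: ideal_down (idealP I) _ _ (tri x y z) _.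
  exact: ideal_add (idealP I) _ _ _ _.
apply: ideal_down (idealP I) _ _ (tri z y x) _.
exact: ideal_add (idealP I) _ _ _ _.
Qed.

Canonical mvequiv_equiv :=
  EquivRel mvequiv mvequiv_refl mvequiv_sym mvequiv_trans.

Definition mvquot := {eq_quot mvequiv_equiv}.

HB.instance Definition _ := Choice.on mvquot.
HB.instance Definition _ := EqQuotient.on mvquot.

Definition mvquot0 : mvquot := \pi_mvquot mv0.
Definition mvquot_add : mvquot -> mvquot -> mvquot := lift_op2 mvquot mvadd.
Definition mvquot_neg : mvquot -> mvquot := lift_op1 mvquot mvneg.

Lemma mvquotE x y : (\pi_mvquot x = \pi_mvquot y) <-> mvequiv x y.
Proof. by split=> /eqmodP. Qed.

Lemma pi_mvadd x y : mvquot_add (\pi_mvquot x) (\pi_mvquot y) = \pi_mvquot (x ⊕ y).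
Proof.
have le_add (a b c d : A) : mvle ((a ⊕ c) ⊖ (b ⊕ d)) ((a ⊖ b) ⊕ (c ⊖ d)).
  rewrite mvle_sub mvaddA -[b ⊕ d ⊕ _]mvaddA [d ⊕ _]mvaddC !mvaddA -mvaddA.
  by apply: mvle_add; rewrite mvle_addsub.
unlock mvquot_add; apply/mvquotE/mvequivE.
have /mvquotE/mvequivE[xx' x'x] := reprK (\pi_mvquot x).
have /mvquotE/mvequivE[yy' y'y] := reprK (\pi_mvquot y).
split; apply: ideal_down (idealP I) _ _ (le_add _ _ _ _) _.
  exact: ideal_add (idealP I) _ _ _ _.
exact: ideal_add (idealP I) _ _ _ _.
Qed.

Lemma pi_mvneg x : mvquot_neg (\pi_mvquot x) = \pi_mvquot (¬ x).
Proof.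
unlock mvquot_neg; apply/mvquotE/mvequivE; rewrite /mvsub !mvnegK.
have /mvquotE/mvequivE[xx' x'x] := reprK (\pi_mvquot x).
by rewrite [_ ⊕ ¬ x]mvaddC [_ ⊕ ¬ repr _]mvaddC.
Qed.

Fact mvquot_addA : associative mvquot_add.
Proof.
by move=> p q r; elim/quotW: p => x; elim/quotW: q => y; elim/quotW: r => z; rewrite !pi_mvadd mvaddA.
Qed.

Fact mvquot_addC : commutative mvquot_add.
Proof. by move=> p q; elim/quotW: p => x; elim/quotW: q => y; rewrite !pi_mvadd mvaddC. Qed.

Fact mvquot_add0 : right_id mvquot0 mvquot_add.
Proof. by move=> p; elim/quotW: p => x; rewrite !pi_mvadd mvadd0. Qed.

Fact mvquot_negK : involutive mvquot_neg.
Proof. by move=> p; elim/quotW: p => x; rewrite !pi_mvneg mvnegK. Qed.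

Fact mvquot_add_neg0 p :
  mvquot_add p (mvquot_neg mvquot0) = mvquot_neg mvquot0.
Proof. by elim/quotW: p => x; rewrite pi_mvneg pi_mvadd mvadd_neg0. Qed.

Fact mvquot_lukasiewicz p q :
  mvquot_add (mvquot_neg (mvquot_add (mvquot_neg p) q)) q =
  mvquot_add (mvquot_neg (mvquot_add (mvquot_neg q) p)) p.
Proof.
elim/quotW: p => x; elim/quotW: q => y.
by rewrite !(pi_mvneg, pi_mvadd) mvlukasiewicz.
Qed.

HB.instance Definition _ := Choice_isMV.Build mvquot mvquot_addA mvquot_addC
  mvquot_add0 mvquot_negK mvquot_add_neg0 mvquot_lukasiewicz.

Lemma mvquot_addE x y : (\pi_mvquot x : mvquot) ⊕ \pi_mvquot y = \pi_mvquot (x ⊕ y).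
Proof. exact: pi_mvadd. Qed.

Lemma mvquot_negE x : ¬ (\pi_mvquot x : mvquot) = \pi_mvquot (¬ x).
Proof. exact: pi_mvneg. Qed.

Lemma mvquot_subE x y : (\pi_mvquot x : mvquot) ⊖ \pi_mvquot y = \pi_mvquot (x ⊖ y).
Proof. by rewrite /mvsub !(mvquot_negE, mvquot_addE). Qed.

Lemma mvquot_le x y : mvle x y -> mvle (\pi_mvquot x : mvquot) (\pi_mvquot y).
Proof. by rewrite /mvle mvquot_subE => /eqP ->. Qed.

End Quotient.

(** * PMV_f-algebras *)

HB.mixin Record MV_isPMVf A of MV A := {
  pmul : A -> A -> A;
  pmulA : associative pmul;
  pmulC : commutative pmul;
  pmulx0 : forall a, pmul a mv0 = mv0;
  pmul_le_add : forall a b c : A, mvle (pmul a (b ⊕ c)) (pmul a b ⊕ pmul a c);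
  pmul_le_meet : forall a b : A, mvle (pmul a b) (mvmeet a b);
  pmul_sub : forall a b c : A, pmul a (b ⊖ c) = pmul a b ⊖ pmul a c
}.

#[short(type="pmvfType")]
HB.structure Definition PMVf := {A of MV_isPMVf A & MV A}.
Bind Scope mv_scope with PMVf.sort.

Section PMVfQuotient.
Variables (A : pmvfType) (I : ideal A).
Local Notation Q := (mvquot I).

Definition mvquot_mul : Q -> Q -> Q := lift_op2 Q pmul.

Lemma mvquot_mulE x y : mvquot_mul (\pi_Q x) (\pi_Q y) = \pi_Q (pmul x y).
Proof.
have le_mul (a b c : A) : mvle (pmul a b ⊖ pmul a c) (b ⊖ c).
  rewrite -pmul_sub; apply: (mvle_trans (pmul_le_meet _ _)).
  by have := mvle_refl (mvmeet a (b ⊖ c)); rewrite mvle_meet => /andP[].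
have congr (a b c : A) : \pi_Q b = \pi_Q c -> \pi_Q (pmul a b) = \pi_Q (pmul a c).
  move=> /mvquotE/mvequivE[bc cb]; apply/mvquotE/mvequivE.
  by split; apply: ideal_down (idealP I) _ _ (le_mul _ _ _) _.
unlock mvquot_mul; rewrite (congr _ _ y (reprK _)) pmulC.
by rewrite (congr _ _ x (reprK _)) pmulC.
Qed.

Fact mvquot_mulA : associative mvquot_mul.
Proof.
by move=> p q r; elim/quotW: p => x; elim/quotW: q => y; elim/quotW: r => z; rewrite !mvquot_mulE pmulA.
Qed.

Fact mvquot_mulC : commutative mvquot_mul.
Proof. by move=> p q; elim/quotW: p => x; elim/quotW: q => y; rewrite !mvquot_mulE pmulC. Qed.

Fact mvquot_mulx0 (p : Q) : mvquot_mul p mv0 = mv0.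
Proof. by elim/quotW: p => x; rewrite mvquot_mulE pmulx0. Qed.

Fact mvquot_mul_le_add (p q r : Q) :
  mvle (mvquot_mul p (q ⊕ r)) (mvquot_mul p q ⊕ mvquot_mul p r).
Proof.
elim/quotW: p => x; elim/quotW: q => y; elim/quotW: r => z.
rewrite mvquot_addE !mvquot_mulE mvquot_addE.
exact/mvquot_le/pmul_le_add.
Qed.

Fact mvquot_mul_le_meet (p q : Q) : mvle (mvquot_mul p q) (mvmeet p q).
Proof.
elim/quotW: p => x; elim/quotW: q => y.
by rewrite /mvmeet !mvquot_subE mvquot_mulE; apply/mvquot_le/pmul_le_meet.
Qed.

Fact mvquot_mul_sub (p q r : Q) :
  mvquot_mul p (q ⊖ r) = mvquot_mul p q ⊖ mvquot_mul p r.
Proof.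
elim/quotW: p => x; elim/quotW: q => y; elim/quotW: r => z.
by rewrite mvquot_subE !mvquot_mulE mvquot_subE pmul_sub.
Qed.

HB.instance Definition _ := MV_isPMVf.Build (mvquot I) mvquot_mulA mvquot_mulC
  mvquot_mulx0 mvquot_mul_le_add mvquot_mul_le_meet mvquot_mul_sub.

End PMVfQuotient.

Record pmvf_embedding (A B : pmvfType) (f : A -> B) : Prop := PMVfEmbedding {
  pmvf_emb_inj : injective f;
  pmvf_emb0 : f mv0 = mv0;
  pmvf_emb_add : {morph f : x y / x ⊕ y};
  pmvf_emb_neg : {morph f : x / ¬ x};
  pmvf_emb_mul : {morph f : x y / pmul x y}
}.

(** * Boolean algebras as PMV_f-algebras *)

Section BooleanPMVf.
Variables (d : Order.disp_t) (T : ctbDistrLatticeType d).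
Local Open Scope order_scope.

Definition boolean_pmvf : Type := T.
Local Notation B := boolean_pmvf.

HB.instance Definition _ := Choice.on B.

Fact boolean_joinA : associative (@Order.join d T).
Proof. exact: joinA. Qed.
Fact boolean_joinC : commutative (@Order.join d T).
Proof. exact: joinC. Qed.
Fact boolean_joinx0 : right_id \bot (@Order.join d T).
Proof. exact: joinx0. Qed.
Fact boolean_complK : involutive (@Order.compl d T).
Proof. exact: complK. Qed.
Fact boolean_joinx1 (x : T) : x `|` ~` \bot = ~` \bot.
Proof. by rewrite compl0 joinx1. Qed.
Fact boolean_lukasiewicz (x y : T) :
  ~` (~` x `|` y) `|` y = ~` (~` y `|` x) `|` x.
Proof.
by rewrite !complU !complK !joinIl !joinCx !meetx1 joinC.
Qed.

HB.instance Definition _ := Choice_isMV.Build B boolean_joinA boolean_joinC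
  boolean_joinx0 boolean_complK boolean_joinx1 boolean_lukasiewicz.

Lemma boolean_addE (x y : B) : x ⊕ y = (x : T) `|` y. Proof. by []. Qed.
Lemma boolean_negE (x : B) : ¬ x = ~` (x : T). Proof. by []. Qed.
Lemma boolean_subE (x y : B) : x ⊖ y = (x : T) `&` ~` (y : T).
Proof. by rewrite /mvsub boolean_addE !boolean_negE complU complK. Qed.
Lemma boolean_meetE (x y : B) : mvmeet x y = (x : T) `&` y.
Proof.
rewrite /mvmeet !boolean_subE complI complK meetUr.
by rewrite meetxC join0x.
Qed.
Lemma boolean_leE (x y : B) : mvle x y = ((x : T) <= y).
Proof.
apply/eqP/idP => [|xy]; rewrite boolean_subE.
  move=> xy0; have : (x : T) `&` (y `|` ~` (y : T)) = x by rewrite joinxC meetx1.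
  by rewrite meetUr xy0 joinx0 => <-; rewrite leIr.
by apply/eqP; rewrite -lex0 -[X in _ <= X](meetxC (y : T)) leI2.
Qed.

Fact boolean_meetA : associative (@Order.meet d T).
Proof. exact: meetA. Qed.
Fact boolean_meetC : commutative (@Order.meet d T).
Proof. exact: meetC. Qed.
Fact boolean_meetx0 (x : T) : x `&` \bot = \bot.
Proof. exact: meetx0. Qed.
Fact boolean_meet_le_add (x y z : B) :
  mvle ((x : T) `&` (y ⊕ z) : B) (((x : T) `&` y : B) ⊕ ((x : T) `&` z : B)).
Proof. by rewrite boolean_leE !boolean_addE meetUr. Qed.
Fact boolean_meet_le_meet (x y : B) : mvle ((x : T) `&` y : B) (mvmeet x y).
Proof. by rewrite boolean_leE boolean_meetE. Qed.
Fact boolean_meet_sub (x y z : B) :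
  (x : T) `&` (y ⊖ z) = ((x : T) `&` y : B) ⊖ ((x : T) `&` z : B).
Proof.
rewrite !boolean_subE complI meetUr.
have -> : (x : T) `&` y `&` ~` (x : T) = \bot.
  by rewrite meetAC meetxC meet0x.
by rewrite join0x meetA.
Qed.

HB.instance Definition _ := MV_isPMVf.Build B boolean_meetA boolean_meetC
  boolean_meetx0 boolean_meet_le_add boolean_meet_le_meet boolean_meet_sub.

End BooleanPMVf.

(** * The PMV_f-algebra 2^X *)

Definition cube (X : Type) : Type := X -> bool.

Section Cube.
Variable X : Type.
Local Notation C := (cube X).
Implicit Types f g h : C.

HB.instance Definition _ := Choice.copy C (forall _ : X, bool).

Definition cube0 : C := fun=> false.
Definition cube_or f g : C := fun x => f x || g x.
Definition cube_not f : C := fun x => ~~ f x.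
Definition cube_and f g : C := fun x => f x && g x.

Fact cube_orA : associative cube_or.
Proof. by move=> f g h; apply/funext=> x; apply: orbA. Qed.
Fact cube_orC : commutative cube_or.
Proof. by move=> f g; apply/funext=> x; apply: orbC. Qed.
Fact cube_orx0 : right_id cube0 cube_or.
Proof. by move=> f; apply/funext=> x; apply: orbF. Qed.
Fact cube_notK : involutive cube_not.
Proof. by move=> f; apply/funext=> x; apply: negbK. Qed.
Fact cube_orx1 f : cube_or f (cube_not cube0) = cube_not cube0.
Proof. by apply/funext=> x; apply: orbT. Qed.
Fact cube_lukasiewicz f g :
  cube_or (cube_not (cube_or (cube_not f) g)) g =
  cube_or (cube_not (cube_or (cube_not g) f)) f.
Proof.
by apply/funext=> x; rewrite /cube_or /cube_not; case: (f x) (g x) => [] [].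
Qed.

HB.instance Definition _ := Choice_isMV.Build C cube_orA cube_orC
  cube_orx0 cube_notK cube_orx1 cube_lukasiewicz.

Fact cube_andA : associative cube_and.
Proof. by move=> f g h; apply/funext=> x; apply: andbA. Qed.
Fact cube_andC : commutative cube_and.
Proof. by move=> f g; apply/funext=> x; apply: andbC. Qed.
Fact cube_andx0 f : cube_and f mv0 = mv0.
Proof. by apply/funext=> x; apply: andbF. Qed.
Fact cube_le_pointwise f g : (forall x, f x -> g x) -> mvle f g.
Proof.
move=> fg; apply/eqP/funext=> x; move: (fg x).
rewrite /mvsub /= /mvneg /mvadd /= /cube_not /cube_or /mv0 /= /cube0.
by case: (f x) (g x) => [] [] // /(_ isT).
Qed.
Fact cube_and_le_add f g h :
  mvle (cube_and f (g ⊕ h)) (cube_and f g ⊕ cube_and f h).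
Proof.
apply: cube_le_pointwise => x; rewrite /cube_and /mvadd /= /cube_or.
by case: (f x) (g x) (h x) => [] [] [].
Qed.
Fact cube_and_le_meet f g : mvle (cube_and f g) (mvmeet f g).
Proof.
apply: cube_le_pointwise => x.
rewrite /mvmeet /mvsub /cube_and /mvneg /mvadd /= /cube_or /cube_not.
by case: (f x) (g x) => [] [].
Qed.
Fact cube_and_sub f g h : cube_and f (g ⊖ h) = cube_and f g ⊖ cube_and f h.
Proof.
apply/funext=> x.
rewrite /mvsub /cube_and /mvneg /mvadd /= /cube_or /cube_not.
by case: (f x) (g x) (h x) => [] [] [].
Qed.

HB.instance Definition _ := MV_isPMVf.Build C cube_andA cube_andC
  cube_andx0 cube_and_le_add cube_and_le_meet cube_and_sub.

End Cube.

(** * l-rings with a strong unit *)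

(* The operations of an l-ring with a distinguished element; the axioms are
   stated separately.  Rings need not have a multiplicative identity, and the
   distinguished element [lru] need not be one. *)
Record lrSig := LrSig {
  lr_sort :> Type;
  lr0 : lr_sort;
  lradd : lr_sort -> lr_sort -> lr_sort;
  lropp : lr_sort -> lr_sort;
  lrmul : lr_sort -> lr_sort -> lr_sort;
  lrle : lr_sort -> lr_sort -> Prop;
  lrmeet : lr_sort -> lr_sort -> lr_sort;
  lrjoin : lr_sort -> lr_sort -> lr_sort;
  lru : lr_sort
}.

Arguments lr0 {_}.
Arguments lru {_}.

Record is_lring (R : lrSig) : Prop := IsLring {
  lraddA : associative (@lradd R);
  lraddC : commutative (@lradd R);
  lradd0 : right_id lr0 (@lradd R);
  lraddN : right_inverse lr0 (@lropp R) (@lradd R);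
  lrmulA : associative (@lrmul R);
  lrmulC : commutative (@lrmul R);
  lrmulDr : right_distributive (@lrmul R) (@lradd R);
  lrle_refl : forall x : R, lrle x x;
  lrle_anti : forall x y : R, lrle x y -> lrle y x -> x = y;
  lrle_trans : forall x y z : R, lrle x y -> lrle y z -> lrle x z;
  lrle_meet : forall x y z : R, lrle z (lrmeet x y) <-> lrle z x /\ lrle z y;
  lrle_join : forall x y z : R, lrle (lrjoin x y) z <-> lrle x z /\ lrle y z;
  lrle_add2r : forall x y z : R, lrle x y -> lrle (lradd x z) (lradd y z);
  lrmul_ge0 : forall x y : R, lrle lr0 x -> lrle lr0 y -> lrle lr0 (lrmul x y)
}.

Definition lrmuln (R : lrSig) (n : nat) (x : R) : R := iter n (lradd x) lr0.
Definition lrabs (R : lrSig) (x : R) : R := lrjoin x (lropp x).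

Definition is_strong_unit (R : lrSig) (u : R) : Prop :=
  lrle lr0 u /\ forall x : R, exists n : nat, lrle (lrabs x) (lrmuln n u).

Definition is_luring (R : lrSig) : Prop := is_lring R /\ is_strong_unit (@lru R).

Definition is_semi_low (R : lrSig) : Prop :=
  forall a b : R, lrle lr0 a -> lrle a lru -> lrle lr0 b -> lrle b lru ->
    lrle (lrmul a b) (lrmeet a b).

Definition is_fring (R : lrSig) : Prop :=
  is_lring R /\
  forall a b c : R, lrmeet a b = lr0 -> lrle lr0 c ->
    lrmeet (lrmul a c) b = lr0 /\ lrmeet a (lrmul c b) = lr0.

Definition is_semi_low_furing (R : lrSig) : Prop :=
  [/\ is_luring R, is_fring R & is_semi_low R].

Record lr_embedding (R S : lrSig) (f : R -> S) : Prop := LrEmbedding {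
  lr_emb_inj : injective f;
  lr_emb0 : f lr0 = lr0;
  lr_emb_add : {morph f : x y / lradd x y};
  lr_emb_opp : {morph f : x / lropp x};
  lr_emb_mul : {morph f : x y / lrmul x y};
  lr_emb_le : forall x y, lrle (f x) (f y) <-> lrle x y;
  lr_emb_meet : {morph f : x y / lrmeet x y};
  lr_emb_join : {morph f : x y / lrjoin x y};
  lr_embu : f lru = lru
}.

Definition lr_prod (I : Type) (R : I -> lrSig) : lrSig :=
  {| lr_sort := forall i, R i;
     lr0 := fun i => lr0;
     lradd := fun f g i => lradd (f i) (g i);
     lropp := fun f i => lropp (f i);
     lrmul := fun f g i => lrmul (f i) (g i);
     lrle := fun f g => forall i, lrle (f i) (g i);
     lrmeet := fun f g i => lrmeet (f i) (g i);
     lrjoin := fun f g i => lrjoin (f i) (g i);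
     lru := fun i => lru |}.

Record is_sublring (R : lrSig) (S : set R) : Prop := IsSublring {
  sublr0 : S lr0;
  sublr_add : forall x y, S x -> S y -> S (lradd x y);
  sublr_opp : forall x, S x -> S (lropp x);
  sublr_mul : forall x y, S x -> S y -> S (lrmul x y);
  sublr_meet : forall x y, S x -> S y -> S (lrmeet x y);
  sublr_join : forall x y, S x -> S y -> S (lrjoin x y)
}.

Definition lr_sub (R : lrSig) (S : set R) (SS : is_sublring S) (Su : S lru) :
    lrSig :=
  {| lr_sort := {x : R | S x};
     lr0 := exist _ _ (sublr0 SS);
     lradd := fun x y => exist _ _ (sublr_add SS (proj2_sig x) (proj2_sig y));
     lropp := fun x => exist _ _ (sublr_opp SS (proj2_sig x));
     lrmul := fun x y => exist _ _ (sublr_mul SS (proj2_sig x) (proj2_sig y));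
     lrle := fun x y => lrle (proj1_sig x) (proj1_sig y);
     lrmeet := fun x y => exist _ _ (sublr_meet SS (proj2_sig x) (proj2_sig y));
     lrjoin := fun x y => exist _ _ (sublr_join SS (proj2_sig x) (proj2_sig y));
     lru := exist _ _ Su |}.

Lemma smallest_sublring (R : lrSig) (G : set R) :
  is_sublring (smallest (@is_sublring R) G).
Proof.
split; first by move=> S [SS _]; apply: sublr0 SS.
- by move=> x y Gx Gy S SG; case: (SG) => SS _;
     exact: (sublr_add SS (Gx S SG) (Gy S SG)).
- by move=> x Gx S SG; case: (SG) => SS _; exact: (sublr_opp SS (Gx S SG)).
- by move=> x y Gx Gy S SG; case: (SG) => SS _;
     exact: (sublr_mul SS (Gx S SG) (Gy S SG)).
- by move=> x y Gx Gy S SG; case: (SG) => SS _;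
     exact: (sublr_meet SS (Gx S SG) (Gy S SG)).
by move=> x y Gx Gy S SG; case: (SG) => SS _;
   exact: (sublr_join SS (Gx S SG) (Gy S SG)).
Qed.

(** * The ring of bounded integer-valued functions *)

Section BoundedFunctions.
Local Open Scope ring_scope.

Definition int_lr : lrSig :=
  {| lr_sort := int;
     lr0 := 0;
     lradd := +%R;
     lropp := -%R;
     lrmul := *%R;
     lrle := fun m n => m <= n;
     lrmeet := Num.min;
     lrjoin := Num.max;
     lru := 1 |}.

Variable X : Type.

Definition bounded_fun : set (lr_prod (fun _ : X => int_lr)) :=
  [set f | exists n : nat, forall x, `|f x : int| <= n%:Z].

Lemma bounded_fun_sublring : is_sublring bounded_fun.
Proof.
have minmax (m n p q : int) : `|m| <= p -> `|n| <= q ->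
    `|Num.min m n| <= p + q /\ `|Num.max m n| <= p + q.
  move=> mp nq; have p0 := le_trans (normr_ge0 _) mp.
  have q0 := le_trans (normr_ge0 _) nq.
  have mpq : `|m| <= p + q by rewrite (le_trans mp) // lerDl.
  have npq : `|n| <= p + q by rewrite (le_trans nq) // lerDr.
  by rewrite /Num.min /Num.max; case: ifP.
split=> [|f g [m mf] [n ng]|f [m mf]|f g [m mf] [n ng]|f g [m mf] [n ng]
  |f g [m mf] [n ng]].
- by exists 0%N => x; rewrite normr0.
- exists (m + n)%N => x; rewrite PoszD (le_trans (ler_normD _ _)) //.
  exact: lerD.
- by exists m => x; rewrite normrN.
- by exists (m * n)%N => x; rewrite PoszM normrM ler_pM.
- by exists (m + n)%N => x; rewrite PoszD; case: (minmax _ _ _ _ (mf x) (ng x)).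
- by exists (m + n)%N => x; rewrite PoszD; case: (minmax _ _ _ _ (mf x) (ng x)).
Qed.

Lemma bounded_fun_unit : bounded_fun lru.
Proof. by exists 1%N => x; rewrite normr1. Qed.

Definition bounded_int_fun : lrSig :=
  lr_sub bounded_fun_sublring bounded_fun_unit.

End BoundedFunctions.

(** * The ring of a totally ordered PMV_f-algebra *)

(* Totality of [A] is not needed to write the construction down; it is used in
   [sharp] for the quotients of an algebra by its prime ideals only. *)

Section ChainSharp.
Variable A : pmvfType.
Local Open Scope ring_scope.

Inductive chain_ident : int * A -> int * A -> Prop :=
  ChainIdent m : chain_ident (m + 1, mv0) (m, mvu).

Definition chain_equiv (p q : int * A) : bool :=
  `[< clos_refl_sym_trans _ chain_ident p q >].

Lemma chain_equiv_refl : reflexive chain_equiv.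
Proof. by move=> p; apply/asboolP; apply: rst_refl. Qed.

Lemma chain_equiv_sym : symmetric chain_equiv.
Proof. by move=> p q; apply/asboolP/asboolP; apply: rst_sym. Qed.

Lemma chain_equiv_trans : transitive chain_equiv.
Proof.
move=> q p r /asboolP pq /asboolP qr; apply/asboolP.
exact: rst_trans pq qr.
Qed.

Canonical chain_equiv_equiv :=
  EquivRel chain_equiv chain_equiv_refl chain_equiv_sym chain_equiv_trans.

Definition chain_sort := {eq_quot chain_equiv_equiv}.

HB.instance Definition _ := Choice.on chain_sort.
HB.instance Definition _ := EqQuotient.on chain_sort.

Implicit Types x y : chain_sort.

Definition chain_class (m : int) (a : A) : chain_sort := \pi_chain_sort (m, a).

Lemma chain_class_ident m : chain_class (m + 1) mv0 = chain_class m mvu.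
Proof. exact/eqmodP/asboolP/rst_step. Qed.

Lemma chain_class_invariant (T : Type) (f : int * A -> T) :
  (forall m, f (m + 1, mv0) = f (m, mvu)) ->
  forall p, f (repr (\pi_chain_sort p)) = f p.
Proof.
move=> ff p; have /eqmodP/asboolP := reprK (\pi_chain_sort p).
by move: (repr _) => q; elim=> {p q} [_ _ [m]|//|//|p q r _ -> _ ->].
Qed.

Definition chain_add_rep (p q : int * A) : chain_sort :=
  let: (m, a) := p in let: (n, b) := q in
  if a ⊕ b == mvu then chain_class (m + n + 1) (a ⊙ b)
  else chain_class (m + n) (a ⊕ b).

Definition chain_opp_rep (p : int * A) : chain_sort :=
  let: (m, a) := p in chain_class (- m - 1) (¬ a).

Definition chain_add x y : chain_sort := chain_add_rep (repr x) (repr y).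
Definition chain_opp x : chain_sort := chain_opp_rep (repr x).

Lemma chain_add_class m n (a b : A) :
  chain_add (chain_class m a) (chain_class n b) = chain_add_rep (m, a) (n, b).
Proof.
have inv p k : chain_add_rep (k + 1, mv0) p = chain_add_rep (k, mvu) p.
  case: p => l c; rewrite /chain_add_rep mvadd0x /mvmul [mvu ⊕ c]mvaddC.
  rewrite mvadd_neg0 eqxx mvnegu mvadd0x mvnegK (addrAC k 1 l).
  by case: eqP => // ->; rewrite mvnegu mvadd0 mvnegK -chain_class_ident.
have comm p q : chain_add_rep p q = chain_add_rep q p.
  case: p q => k c [l e]; rewrite /chain_add_rep /mvmul.
  by rewrite (addrC k) (mvaddC c) (mvaddC (¬ c)).
rewrite /chain_add (chain_class_invariant (f := fun p => chain_add_rep p _)).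
  by rewrite (chain_class_invariant (f := chain_add_rep _)) // => k; rewrite !(comm (m, a)).
by move=> k; apply: inv.
Qed.

Lemma chain_opp_class m (a : A) :
  chain_opp (chain_class m a) = chain_class (- m - 1) (¬ a).
Proof.
rewrite /chain_opp (chain_class_invariant (f := chain_opp_rep)) // => k.
by rewrite /= mvnegu -chain_class_ident opprD subrK.
Qed.

(* The multiple [m x] in the additive group of [chain_sort]. *)
Definition chain_mulz (m : int) x : chain_sort :=
  match m with
  | Posz n => iter n (chain_add x) (chain_class 0 mv0)
  | Negz n => chain_opp (iter n.+1 (chain_add x) (chain_class 0 mv0))
  end.

Definition chain_mul x y : chain_sort :=
  let: (m, a) := repr x in let: (n, b) := repr y in
  chain_add
    (chain_add
      (chain_add (chain_mulz (m * n) (chain_class 0 (pmul mvu mvu)))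
                 (chain_mulz m (chain_class 0 (pmul b mvu))))
      (chain_mulz n (chain_class 0 (pmul a mvu))))
    (chain_class 0 (pmul a b)).

(* If [A] is nontrivial then every class has exactly one representative whose
   second entry is not [mvu].  If [A] is trivial then [chain_sort] has one
   element and no such representative; quantifying universally makes the order
   reflexive in that case as well. *)
Definition chain_le x y : Prop :=
  forall m n (a b : A), a != mvu -> b != mvu ->
    chain_class m a = x -> chain_class n b = y ->
    m < n \/ m = n /\ mvle a b.

(* The infimum and supremum, the order being total. *)
Definition chain_meet x y : chain_sort := if `[< chain_le x y >] then x else y.
Definition chain_join x y : chain_sort := if `[< chain_le x y >] then y else x.

Definition chain_sharp : lrSig :=
  {| lr_sort := chain_sort;
     lr0 := chain_class 0 mv0;
     lradd := chain_add;
     lropp := chain_opp;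
     lrmul := chain_mul;
     lrle := chain_le;
     lrmeet := chain_meet;
     lrjoin := chain_join;
     lru := chain_class 0 mvu |}.

End ChainSharp.

(** * The ring of a PMV_f-algebra *)

Section Sharp.
Variable A : pmvfType.

Definition sharp_ambient : lrSig :=
  lr_prod (fun P : Spec A => chain_sharp (mvquot P)).

Definition sharp_hat (a : A) : sharp_ambient :=
  fun P => chain_class 0%R (\pi_(mvquot P) a).

Definition sharp_set : set sharp_ambient :=
  smallest (@is_sublring sharp_ambient) (range sharp_hat).

Lemma sharp_set_sublring : is_sublring sharp_set.
Proof. exact: smallest_sublring. Qed.

Lemma sharp_hat_unit : sharp_hat mvu = lru.
Proof.
by apply: functional_extensionality_dep => P; rewrite /sharp_hat -mvquot_negE.
Qed.

Lemma sharp_set_unit : sharp_set lru.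
Proof. by rewrite -sharp_hat_unit; apply: sub_gen_smallest; exists mvu. Qed.

Definition sharp : lrSig := lr_sub sharp_set_sublring sharp_set_unit.

End Sharp.

(* Main.v *)
Require Import Defs.
From mathcomp Require Import all_boot all_order.
From mathcomp Require Import all_algebra.
From mathcomp Require Import boolp classical_sets.
From mathcomp Require Import zify.

Set Implicit Arguments.
Unset Strict Implicit.
Unset Printing Implicit Defensive.

Import Order.Theory GRing.Theory Num.Theory.
Local Open Scope quotient_scope.
Local Open Scope classical_set_scope.
Local Open Scope mv_scope.

(** This is Stone duality, lifted from 2 to the integers.  The set X consists of
    the proper prime ideals P of A.  The Stone map sends a to the set of those P
    that do not contain a ([stone_embedding]); it is injective because a maximal
    ideal avoiding a given nonzero element is prime ([prime_ideal_avoiding]).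

    For P in X the quotient A/P has exactly the elements 0 and u, so each element
    of its ring has a unique representative (n, 0), and reading off n identifies
    the ring with the integers ([chain_val_embedding]).  The quotient by the
    improper ideal has one element, and so has its ring ([chain_sharp_trivial]);
    this factor can be dropped without losing information.  Hence the product
    that contains the ring of A embeds in the ring of all functions from X to the
    integers ([sharp_eval_embedding]).  The functions with bounded image form a
    sub-l-ring that contains the image of every generator, a function with
    values 0 and 1, hence the image of the whole ring ([sharp_eval_bounded]).

    The axioms of a semi-low f-ring with strong unit are inherited along any
    embedding that preserves the unit ([semi_low_furing_of_embedding]): they are
    universal, except that every element is bounded by some multiple of the unit,
    and the same multiple works before and after the embedding.  So they need
    only be verified for the bounded functions, where they follow from those of
    the integers, and the ring of A gets them from its embedding. *)

(** * Transfer of l-ring properties *)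

Section Embedding.
Variables (R S : lrSig) (f : R -> S).
Hypothesis fE : lr_embedding f.

Lemma lring_of_embedding : is_lring S -> is_lring R.
Proof.
case: fE => finj f0 fD fN fM fle fI fU _ [AA AC A0 AN MA MC MD le1 lea let_ lI lU leD M0].
split.
- by move=> x y z; apply: finj; rewrite !fD AA.
- by move=> x y; apply: finj; rewrite !fD AC.
- by move=> x; apply: finj; rewrite fD f0 A0.
- by move=> x; apply: finj; rewrite fD fN f0 AN.
- by move=> x y z; apply: finj; rewrite !fM MA.
- by move=> x y; apply: finj; rewrite !fM MC.
- by move=> x y z; apply: finj; rewrite !(fM, fD) MD.
- by move=> x; apply/fle.
- by move=> x y /fle xy /fle yx; apply/finj/lea.
- by move=> x y z /fle xy /fle yz; apply/fle/(let_ _ _ _ xy yz).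
- by move=> x y z; rewrite -!fle fI lI.
- by move=> x y z; rewrite -!fle fU lU.
- by move=> x y z /fle xy; apply/fle; rewrite !fD; apply: leD.
- by move=> x y /fle x0 /fle y0; apply/fle; rewrite fM f0; apply: M0; rewrite -f0.
Qed.

Lemma fring_of_embedding : is_fring S -> is_fring R.
Proof.
case=> lS fS; split; first exact: lring_of_embedding.
case: fE => finj f0 fD fN fM fle fI fU _ a b c ab c0.
have [] := fS (f a) (f b) (f c).
- by rewrite -fI ab f0.
- by rewrite -f0; apply/fle.
by move=> e1 e2; split; apply: finj; rewrite fI fM f0.
Qed.

Lemma semi_low_of_embedding : is_semi_low S -> is_semi_low R.
Proof.
case: fE => finj f0 fD fN fM fle fI fU fu sS a b /fle a0 /fle a1 /fle b0 /fle b1.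
by apply/fle; rewrite fM fI; apply: sS; rewrite -?f0 -?fu.
Qed.

Lemma strong_unit_of_embedding :
  is_strong_unit (@lru S) -> is_strong_unit (@lru R).
Proof.
case: fE => finj f0 fD fN fM fle fI fU fu [u0 ub].
split=> [|x]; first by apply/fle; rewrite f0 fu.
have [n xn] := ub (f x); exists n; apply/fle.
suff -> : f (lrmuln n lru) = lrmuln n lru by rewrite /lrabs fU fN.
by rewrite /lrmuln; elim: n {xn} => //= n <-; rewrite fD fu.
Qed.

Lemma semi_low_furing_of_embedding : is_semi_low_furing S -> is_semi_low_furing R.
Proof.
case=> -[lS uS] fS sS; split.
- by split; [exact: lring_of_embedding | exact: strong_unit_of_embedding].
- exact: fring_of_embedding.
- exact: semi_low_of_embedding.
Qed.

End Embedding.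

Section Product.
Variables (I : Type) (R : I -> lrSig).

Lemma lring_prod : (forall i, is_lring (R i)) -> is_lring (lr_prod R).
Proof.
move=> lR; split.
- by move=> x y z; apply: functional_extensionality_dep => i; apply: lraddA (lR i) _ _ _.
- by move=> x y; apply: functional_extensionality_dep => i; apply: lraddC (lR i) _ _.
- by move=> x; apply: functional_extensionality_dep => i; apply: lradd0 (lR i) _.
- by move=> x; apply: functional_extensionality_dep => i; apply: lraddN (lR i) _.
- by move=> x y z; apply: functional_extensionality_dep => i; apply: lrmulA (lR i) _ _ _.
- by move=> x y; apply: functional_extensionality_dep => i; apply: lrmulC (lR i) _ _.
- by move=> x y z; apply: functional_extensionality_dep => i; apply: lrmulDr (lR i) _ _ _.
- by move=> x i; apply: lrle_refl (lR i) _.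
- move=> x y xy yx; apply: functional_extensionality_dep => i.
  exact: lrle_anti (lR i) _ _ (xy i) (yx i).
- by move=> x y z xy yz i; apply: lrle_trans (lR i) _ _ _ (xy i) (yz i).
- move=> x y z; split=> [h|[h1 h2] i]; last exact/(lrle_meet (lR i)).
  by split=> i; case/(lrle_meet (lR i)): (h i).
- move=> x y z; split=> [h|[h1 h2] i]; last exact/(lrle_join (lR i)).
  by split=> i; case/(lrle_join (lR i)): (h i).
- by move=> x y z xy i; apply: lrle_add2r (lR i) _ _ _ (xy i).
- by move=> x y x0 y0 i; apply: lrmul_ge0 (lR i) _ _ (x0 i) (y0 i).
Qed.

Lemma fring_prod : (forall i, is_fring (R i)) -> is_fring (lr_prod R).
Proof.
move=> fR; split; first by apply: lring_prod => i; case: (fR i).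
move=> a b c ab c0.
have h i := (fR i).2 (a i) (b i) (c i) (congr1 (fun z : lr_prod R => z i) ab) (c0 i).
by split; apply: functional_extensionality_dep => i; case: (h i).
Qed.

Lemma semi_low_prod : (forall i, is_semi_low (R i)) -> is_semi_low (lr_prod R).
Proof. by move=> sR a b a0 a1 b0 b1 i; apply: sR. Qed.

End Product.

Lemma lr_sub_inj (R : lrSig) (S : set R) : injective (@proj1_sig R S).
Proof.
by move=> [x Sx] [y Sy] /= xy; subst y; rewrite (Prop_irrelevance Sx Sy).
Qed.

Lemma lr_sub_embedding (R S : lrSig) (U : set R) (V : set S)
    (SU : is_sublring U) (Uu : U lru) (SV : is_sublring V) (Vu : V lru)
    (f : R -> S) (fUV : forall x, U x -> V (f x)) :
  lr_embedding f ->
  lr_embedding (fun x : lr_sub SU Uu =>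
    exist _ (f (proj1_sig x)) (fUV _ (proj2_sig x)) : lr_sub SV Vu).
Proof.
case=> finj f0 fD fN fM fle fI fU fu; split.
- by move=> x y [] /finj /lr_sub_inj.
- exact: lr_sub_inj.
- by move=> x y; apply: lr_sub_inj; apply: fD.
- by move=> x; apply: lr_sub_inj; apply: fN.
- by move=> x y; apply: lr_sub_inj; apply: fM.
- by move=> x y; apply: fle.
- by move=> x y; apply: lr_sub_inj; apply: fI.
- by move=> x y; apply: lr_sub_inj; apply: fU.
- exact: lr_sub_inj.
Qed.

Lemma lr_sub_val_embedding (R : lrSig) (U : set R) (SU : is_sublring U)
    (Uu : U lru) :
  lr_embedding (fun x : lr_sub SU Uu => proj1_sig x).
Proof. by split=> //; apply: lr_sub_inj. Qed.

(** Shows that a map sends a generated sub-l-ring into [V] as soon as it sends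
    the generators into [V]. *)
Lemma preimage_sublring (R S : lrSig) (f : R -> S) (V : set S) :
  lr_embedding f -> is_sublring V -> is_sublring (f @^-1` V).
Proof.
case=> _ f0 fD fN fM _ fI fU _ [V0 VD VN VM VI VU].
split; rewrite /preimage /=.
- by rewrite f0.
- by move=> x y; rewrite fD; apply: VD.
- by move=> x; rewrite fN; apply: VN.
- by move=> x y; rewrite fM; apply: VM.
- by move=> x y; rewrite fI; apply: VI.
- by move=> x y; rewrite fU; apply: VU.
Qed.

(** * Bounded integer-valued functions *)

Section BoundedFunctions.
Local Open Scope ring_scope.

Lemma int_fring : is_fring int_lr.
Proof.
split; last by rewrite /=; nia.
split; rewrite /=; try by [lia|nia].
- exact: addrA.
- exact: addrC.
- exact: addr0.
- exact: addrN.
- exact: mulrA.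
- exact: mulrC.
- exact: mulrDr.
Qed.

Lemma int_semi_low : is_semi_low int_lr.
Proof. rewrite /is_semi_low /=; nia. Qed.

Lemma bounded_int_fun_semi_low_furing (X : Type) :
  is_semi_low_furing (bounded_int_fun X).
Proof.
have iE := lr_sub_val_embedding (bounded_fun_sublring X) (bounded_fun_unit X).
have fB : is_fring (bounded_int_fun X).
  by apply: (fring_of_embedding iE); apply: fring_prod => _; apply: int_fring.
split=> //; last first.
  by apply: (semi_low_of_embedding iE); apply: semi_low_prod => _; apply: int_semi_low.
split; first by case: fB.
split=> [x //|f]; case: (proj2_sig f) => n fn; exists n => x /=.
suff -> : proj1_sig (lrmuln n (lru : bounded_int_fun X)) x = n%:Z.
  by move: (fn x) => /=; lia.
by rewrite /lrmuln; elim: n {fn} => //= n ->; lia.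
Qed.

End BoundedFunctions.

(** * The ring of a chain with at most two elements *)

Lemma trivial_mv (A : mvType) (a : A) : (mv0 : A) = mvu -> a = mvu.
Proof. by move=> e0u; rewrite -(mvadd0 a) e0u mvadd_neg0. Qed.

Section TwoElementSharp.
Variable Q : pmvfType.
Local Open Scope ring_scope.
Local Notation S := (chain_sharp Q).

(** The identification of (m + 1, 0) with (m, u) becomes that of (m + 1, 0) with
    (m, 0), so all integers collapse. *)
Lemma chain_sharp_trivial : (mv0 : Q) = mvu -> forall x y : S, x = y.
Proof.
move=> e0u.
have all0 (a : Q) : a = mv0 by rewrite (trivial_mv a e0u).
have step (m : int) : chain_class (m + 1) (mv0 : Q) = chain_class m mv0.
  by rewrite chain_class_ident e0u.
have class0 (m : int) : chain_class m (mv0 : Q) = chain_class 0 mv0.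
  elim/int_ind: m => // n IH; first by rewrite -addn1 PoszD step.
  by rewrite -step -IH; congr chain_class; lia.
suff h (x : chain_sort Q) : x = chain_class 0 mv0 by move=> x y; rewrite (h x) (h y).
elim/quotW: x => -[m a]; rewrite (all0 a); exact: class0.
Qed.

(** The integer n such that x is the class of (n, 0); the summand 1 accounts for
    the representatives (n - 1, u). *)
Definition chain_val (x : S) : int_lr :=
  let: (m, a) := repr (x : chain_sort Q) in m + ((a == mvu) : nat)%:Z.

Hypothesis Q0u : (mv0 : Q) != mvu.
Hypothesis Qtwo : forall q : Q, q = mv0 \/ q = mvu.
Hypothesis Quu : pmul (mvu : Q) mvu = mvu.

Lemma chain_val_class m (a : Q) :
  chain_val (chain_class m a) = m + ((a == mvu) : nat)%:Z.
Proof.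
rewrite /chain_val (chain_class_invariant
  (f := fun p => let: (m, a) := p in m + ((a == mvu) : nat)%:Z)) // => k.
by rewrite (negbTE Q0u) eqxx addr0.
Qed.

Lemma chain_valK (x : chain_sort Q) : chain_class (chain_val x) mv0 = x.
Proof.
elim/quotW: x => -[m a]; rewrite -[\pi_(_) _]/(chain_class m a) chain_val_class.
case: (Qtwo a) => ->; first by rewrite (negbTE Q0u) addr0.
by rewrite eqxx chain_class_ident.
Qed.

Lemma chain_val_add (x y : chain_sort Q) :
  chain_val (chain_add x y) = chain_val x + chain_val y.
Proof.
rewrite -[in LHS](chain_valK x) -[in LHS](chain_valK y) chain_add_class /=.
by rewrite mvadd0 (negbTE Q0u) chain_val_class (negbTE Q0u) addr0.
Qed.

Lemma chain_val_opp (x : chain_sort Q) :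
  chain_val (chain_opp x) = - chain_val x.
Proof.
rewrite -[in LHS](chain_valK x) chain_opp_class chain_val_class -/mvu eqxx.
by rewrite subrK.
Qed.

Lemma chain_val_mulz m (x : chain_sort Q) :
  chain_val (chain_mulz m x) = m * chain_val x.
Proof.
have iterE n : chain_val (iter n (chain_add x) (chain_class 0 mv0)) =
    n%:Z * chain_val x.
  elim: n => [|n IH]; first by rewrite chain_val_class (negbTE Q0u) mul0r.
  by rewrite iterS chain_val_add IH intS mulrDl mul1r.
by case: m => n; rewrite /chain_mulz ?chain_val_opp iterE // NegzE mulNr.
Qed.

(** When a and b are 0 or u and u is idempotent, the four terms of the product
    of (m, a) and (n, b) are those of the expansion of (m + a) (n + b), with u
    read as 1. *)
Lemma chain_val_mul (x y : chain_sort Q) :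
  chain_val (chain_mul x y) = chain_val x * chain_val y.
Proof.
rewrite [RHS]/( _ * _) /= {2 3}/chain_val /chain_mul.
case: (repr x) => m a; case: (repr y) => n b.
rewrite !(chain_val_add, chain_val_mulz, chain_val_class) Quu.
case: (Qtwo a) => ->; case: (Qtwo b) => ->.
all: rewrite ?[pmul mv0 mvu]pmulC ?pmulx0 ?Quu ?eqxx ?(negbTE Q0u) /=; lia.
Qed.

Lemma chain_val_le (x y : chain_sort Q) :
  (chain_val x <= chain_val y) <-> chain_le x y.
Proof.
split=> [xy m n a b a1 b1 ax by_|].
  have [a0|/eqP] := Qtwo a; last by rewrite (negbTE a1).
  have [b0|/eqP] := Qtwo b; last by rewrite (negbTE b1).
  move: xy; rewrite -ax -by_ !chain_val_class a0 b0 (negbTE Q0u) !addr0.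
  by rewrite le_eqVlt => /orP[/eqP|]; [right; split=> //; apply: mvle_refl|left].
move=> /(_ (chain_val x) (chain_val y) mv0 mv0 Q0u Q0u (chain_valK x) (chain_valK y)).
by case=> [/ltW//|[-> _]].
Qed.

Lemma chain_val_embedding : lr_embedding chain_val.
Proof.
split.
- exact: (@can_inj _ _ _ (fun m => chain_class m mv0) chain_valK).
- by rewrite chain_val_class (negbTE Q0u).
- exact: chain_val_add.
- exact: chain_val_opp.
- exact: chain_val_mul.
- exact: chain_val_le.
- move=> x y /=; rewrite /chain_meet minElt.
  by case: asboolP => /chain_val_le; case: ltgtP.
- move=> x y /=; rewrite /chain_join maxElt.
  by case: asboolP => /chain_val_le; case: ltgtP.
- by rewrite chain_val_class eqxx add0r.
Qed.

End TwoElementSharp.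

(** * Prime ideals of a Boolean algebra *)

Lemma mvquot_unit (A : mvType) (I : ideal A) :
  (mvu : mvquot I) = \pi_(mvquot I) mvu.
Proof. exact: mvquot_negE. Qed.

Section PrimeIdeals.
Variables (d : Order.disp_t) (A : ctbDistrLatticeType d).
Local Notation B := (boolean_pmvf A).
Local Open Scope order_scope.

(** An ideal M maximal among those avoiding c is prime: if a and b are not in M,
    then c lies below p joined with a and below q joined with b for
    some p, q in M, hence below the join of p, q and the meet of a and b, which
    is then outside M. *)
Lemma prime_ideal_avoiding (c : A) : c != \bot ->
  exists P : Spec B, ~ P (c : B).
Proof.
move=> c0.
(* Nonemptiness is left out of [good], since the union of the empty chain must
   be good; it is recovered from maximality as [M0] below. *)
pose good (I : set A) := [/\ forall x y, x <= y -> I y -> I x,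
  forall x y, I x -> I y -> I (x `|` y) & ~ I c].
have [F Fgood Ftot|M [[Mdown Madd Mc] Mmax]] := @Zorn_bigcup A good.
  split.
  - move=> x y xy [I FI Iy]; exists I => //.
    by have [dn _ _] := Fgood _ FI; exact: dn _ _ xy Iy.
  - move=> x y [I FI Ix] [J FJ Jy].
    have [IJ|JI] := Ftot _ _ FI FJ.
      by exists J => //; have [_ ad _] := Fgood _ FJ; apply: ad => //; apply: IJ.
    by exists I => //; have [_ ad _] := Fgood _ FI; apply: ad => //; apply: JI.
  - by move=> [I FI Ic]; have [_ _ /(_ Ic)] := Fgood _ FI.
(* The case p = \bot of [ext] is there because M is not yet known to contain
   \bot. *)
have ext x : ~ M x -> exists2 p, M p \/ p = \bot & c <= p `|` x.
  move=> Mx; apply: contrapT => noc.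
  pose J := [set y | exists2 p, M p \/ p = \bot & y <= p `|` x].
  apply: (Mmax J); last split.
  - split=> [y My|/(_ x) JM]; first by exists y; [left|rewrite leUl].
    by apply/Mx/JM; exists \bot; [right|rewrite join0x].
  - by move=> y z yz [p Mp zp]; exists p => //; apply: le_trans zp.
  - move=> y z [p Mp yp] [q Mq zq]; exists (p `|` q).
      case: Mp => [Mp|->]; last by rewrite join0x.
      by case: Mq => [Mq|->]; [left; apply: Madd|rewrite joinx0; left].
    by rewrite -[x]joinxx joinACA leU2.
  - exact: noc.
have M0 : M \bot.
  apply: contrapT => /ext[p Mp]; rewrite joinx0 => cp.
  case: Mp => [Mp|p0]; first by apply/Mc/(Mdown _ _ cp).
  by move: c0; rewrite -lex0 -p0 cp.
suff Mprime : @is_prime_ideal B M by exists (exist _ M Mprime).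
split; first split.
- by exists \bot.
- by move=> x y; rewrite boolean_leE; apply: Mdown.
- exact: Madd.
move=> a b; rewrite boolean_meetE => Mab; apply: contrapT => /not_orP[Ma Mb].
have M0E p : M p \/ p = \bot -> M p by case=> [//|->].
have [p /M0E Mp cp] := ext _ Ma; have [q /M0E Mq cq] := ext _ Mb.
apply/Mc/(Mdown _ (p `|` q `|` (a `&` b))); last exact: Madd (Madd _ _ Mp Mq) Mab.
rewrite joinIr lexI (le_trans cp) ?(le_trans cq) //.
  by rewrite leU2 // leUr.
by rewrite leU2 // leUl.
Qed.

Definition proper_prime : Type := {P : Spec B | ~ P mvu}.

Section OnePrime.
Variable P : Spec B.
Hypothesis Pu : ~ P mvu.

Lemma prime_add (a b : B) : P (a ⊕ b) <-> P a /\ P b.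
Proof.
have [I _] := proj2_sig P; split=> [Pab|[]]; last by move=> Pa Pb; apply: ideal_add I _ _ Pa Pb.
split; apply: ideal_down I _ _ _ Pab; first exact: mvle_addr.
by rewrite mvaddC mvle_addr.
Qed.

Lemma prime_neg (a : B) : P (¬ a) <-> ~ P a.
Proof.
have [I prm] := proj2_sig P; split=> [Pna Pa|nPa].
  by apply: Pu; rewrite -(mvaddNx a); apply: ideal_add I _ _ Pna Pa.
suff /prm[] : P (mvmeet a (¬ a)) by [].
by rewrite boolean_meetE boolean_negE meetxC; exact: (ideal0 P).
Qed.

Lemma prime_mul (a b : B) : P (pmul a b) <-> P a \/ P b.
Proof.
have [I prm] := proj2_sig P; have E : pmul a b = mvmeet a b.
  by rewrite boolean_meetE.
rewrite E; split=> [/prm//|].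
by case; apply: ideal_down I _ _ _; have := mvle_refl (mvmeet a b);
  rewrite mvle_meet => /andP[].
Qed.

Lemma mvquot_prime_zero (a : B) : P a -> \pi_(mvquot P) a = mv0.
Proof.
move=> Pa; apply/mvquotE/mvequivE; split.
  by rewrite boolean_subE compl0 meetx1.
by rewrite (eqP (mvle0 a)); apply: ideal0.
Qed.

Lemma mvquot_prime_unit (a : B) : ~ P a -> \pi_(mvquot P) a = mvu.
Proof.
move=> /prime_neg Pna.
by rewrite -[a]mvnegK -mvquot_negE mvquot_prime_zero.
Qed.

Lemma mvquot_prime_neq : (mv0 : mvquot P) != mvu.
Proof.
apply/eqP => /esym; rewrite mvquot_unit => /mvquotE/mvequivE[+ _].
by rewrite boolean_subE compl0 meetx1; exact: Pu.
Qed.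

Lemma mvquot_prime_two (q : mvquot P) : q = mv0 \/ q = mvu.
Proof.
elim/quotW: q => a; have [Pa|Pa] := pselect (P a).
  by left; apply: mvquot_prime_zero.
by right; apply: mvquot_prime_unit.
Qed.

Lemma mvquot_prime_unit_idem : pmul (mvu : mvquot P) mvu = mvu.
Proof.
rewrite mvquot_unit [LHS]mvquot_mulE; congr (\pi_(_) _).
exact: meetxx.
Qed.

End OnePrime.

Lemma mvquot_improper (P : Spec B) : P mvu -> (mv0 : mvquot P) = mvu.
Proof.
by move=> Pu; rewrite mvquot_unit [RHS]mvquot_prime_zero.
Qed.

(** * The two embeddings *)

Definition stone (a : B) : cube proper_prime :=
  fun P => ~~ `[< sval P a >].

Lemma stone_embedding : pmvf_embedding stone.
Proof.
(* If a is not below b, the nonzero difference of a and b is avoided by some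
   prime ideal, which then contains b but not a. *)
have diff (a b : A) : stone a = stone b -> a <= b.
  move=> ab; apply: contrapT => /negP leab.
  have [|P Pc] := @prime_ideal_avoiding (a `&` ~` b).
    apply: contra leab => /eqP ab0.
    by rewrite -boolean_leE /mvle boolean_subE ab0.
  have Pu : ~ P mvu.
    move=> Pu; apply: Pc; apply: ideal_down (idealP P) _ _ _ Pu.
    by rewrite boolean_leE /mvu boolean_negE compl0 lex1.
  have Pab := congr1 (fun f => f (exist _ P Pu)) ab.
  have [nPa nPnb] : ~ P a /\ ~ P (¬ (b : B)).
    by apply/not_orP => /prime_mul; apply: Pc.
  move: Pab; rewrite /stone /= => /negb_inj; rewrite (asboolF nPa).
  by move/esym/asboolPn => nPb; apply: nPnb; apply/(prime_neg Pu).
split.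
- by move=> a b ab; apply: (@le_anti _ A); rewrite !diff.
- by apply/funext => P; apply/negbTE; rewrite negbK; apply/asboolP/ideal0.
- move=> a b; apply/funext => P; rewrite /stone -[RHS]negb_and -asbool_and.
  by congr (~~ _); apply: asbool_equiv_eq; apply: prime_add.
- move=> a; apply/funext => -[P Pu]; rewrite /stone /=.
  by congr (~~ _); rewrite -asbool_neg; apply: asbool_equiv_eq; apply: prime_neg.
- move=> a b; apply/funext => -[P Pu]; rewrite /stone -[RHS]negb_or -asbool_or.
  by congr (~~ _); apply: asbool_equiv_eq; apply: prime_mul.
Qed.

Definition sharp_eval (s : sharp_ambient B) :
    lr_prod (fun _ : proper_prime => int_lr) :=
  fun P => chain_val (s (sval P)).

Lemma sharp_eval_embedding : lr_embedding sharp_eval.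
Proof.
have E (P : proper_prime) : lr_embedding (@chain_val (mvquot (sval P))).
  case: P => P Pu; apply: chain_val_embedding.
  - exact: mvquot_prime_neq.
  - exact: mvquot_prime_two.
  - exact: mvquot_prime_unit_idem.
split.
- move=> s t st; apply: functional_extensionality_dep => P.
  have [Pu|Pu] := pselect (P mvu).
    exact/chain_sharp_trivial/mvquot_improper.
  exact: (lr_emb_inj (E (exist _ P Pu))
    (congr1 (fun f => f (exist _ P Pu)) st)).
- by apply/funext => P; apply: lr_emb0 (E P).
- by move=> s t; apply/funext => P; apply: lr_emb_add (E P) _ _.
- by move=> s; apply/funext => P; apply: lr_emb_opp (E P) _.
- by move=> s t; apply/funext => P; apply: lr_emb_mul (E P) _ _.
- move=> s t; split=> st P; last exact/(lr_emb_le (E P)).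
  have [Pu|Pu] := pselect (P mvu).
    by move=> m n a b /eqP[]; apply/trivial_mv/mvquot_improper.
  exact/(lr_emb_le (E (exist _ P Pu)))/(st (exist _ P Pu)).
- by move=> s t; apply/funext => P; apply: lr_emb_meet (E P) _ _.
- by move=> s t; apply/funext => P; apply: lr_emb_join (E P) _ _.
- by apply/funext => P; apply: lr_embu (E P).
Qed.

Lemma sharp_eval_bounded (s : sharp_ambient B) :
  sharp_set s -> bounded_fun (sharp_eval s).
Proof.
move=> /(_ (sharp_eval @^-1` @bounded_fun proper_prime)); apply; split.
  exact: preimage_sublring sharp_eval_embedding (bounded_fun_sublring _).
move=> _ [a _ <-]; exists 1%N => -[P Pu].
rewrite /sharp_eval /sharp_hat /= chain_val_class ?mvquot_prime_neq //.
by case: eqP.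
Qed.

End PrimeIdeals.

Theorem mainTheorem6 (d : Order.disp_t) (A : ctbDistrLatticeType d) :
  exists X : Type,
    (exists f : boolean_pmvf A -> cube X, pmvf_embedding f) /\
    is_semi_low_furing (sharp (boolean_pmvf A)) /\
    is_semi_low_furing (bounded_int_fun X) /\
    (exists g : sharp (boolean_pmvf A) -> bounded_int_fun X, lr_embedding g).
Proof.
have gE := lr_sub_embedding (sharp_set_sublring _) (@sharp_set_unit _)
  (bounded_fun_sublring _) (bounded_fun_unit _) (@sharp_eval_bounded d A)
  (@sharp_eval_embedding d A).
have furingB := bounded_int_fun_semi_low_furing (proper_prime A).
exists (proper_prime A); split; first by exists (@stone d A); apply: stone_embedding.
split; first exact: semi_low_furing_of_embedding gE furingB.
by split=> //; eexists; apply: gE.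
Qed.
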